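(* Let $S\in\mathcal{I}_1\cap\mathcal{I}_2$ be such that the shortest $s$–$t$ path in the exchange graph $G(S)$ has length $2(\ell+1)$, and let $\Pi_\ell=(B_1,A_1,B_2,A_2,\dots,B_\ell,A_\ell,B_{\ell+1})$ be an augmenting set in $G(S)$. Then $S\oplus\Pi_\ell:=S+B_1-A_1+B_2-\cdots+B_\ell-A_\ell+B_{\ell+1}$ is a common independent set, i.e. lies in $\mathcal{I}_1\cap\mathcal{I}_2$.
   Context: $\mathcal{M}_1=(V,\mathcal{I}_1)$, $\mathcal{M}_2=(V,\mathcal{I}_2)$ are matroids on a common ground set. For $S\in\mathcal{I}_1\cap\mathcal{I}_2$, the exchange graph $G(S)$ is the directed graph on $V\cup\{s,t\}$ with arcs: $(s,a)$ for $a\notin S$ with $S+a\in\mathcal{I}_1$; $(a,t)$ for $a\notin S$ with $S+a\in\mathcal{I}_2$; $(a,b)$ for $a\in S$, $b\notin S$ with $S-a+b\in\mathcal{I}_1$; $(b,a)$ for $a\in S$, $b\notin S$ with $S-a+b\in\mathcal{I}_2$. $D_i$ denotes the set of elements of $V$ at distance exactly $i$ from $s$ in $G(S)$. An augmenting set in $G(S)$ (where the shortest $s$–$t$ path has length $2(\ell+1)$) is a sequence of sets $(B_1,A_1,B_2,A_2,\dots,A_\ell,B_{\ell+1})$ such that: (a) $A_k\subseteq D_{2k}$ and $B_k\subseteq D_{2k-1}$ for all relevant $k$; (b) $|B_1|=|A_1|=|B_2|=\cdots=|B_{\ell+1}|=w$ ($w$ is the width); (c) $S+B_1\in\mathcal{I}_1$;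 (d) $S+B_{\ell+1}\in\mathcal{I}_2$; (e) $S-A_k+B_{k+1}\in\mathcal{I}_1$ for $1\le k\le\ell$; (f) $S-A_k+B_k\in\mathcal{I}_2$ for $1\le k\le\ell$. Here $X+Y$, $X-Y$ denote union and set difference. *)

(* Defs.v *)
From HB Require Import structures.
From mathcomp Require Import all_boot.

Set Implicit Arguments.
Unset Strict Implicit.
Unset Printing Implicit Defensive.

Record matroid (V : finType) := Matroid {
  indep : {set {set V}};
  indep0 : set0 \in indep;
  indep_sub : forall X Y : {set V},
    X \subset Y -> Y \in indep -> X \in indep;
  indep_exchange : forall X Y : {set V},
    X \in indep -> Y \in indep -> #|X| < #|Y| ->
    exists2 y, y \in Y :\: X & y |: X \in indep
}.

Section Distance.
Variables (T : finType) (e : rel T).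

Definition walk_of_length (x y : T) (n : nat) : bool :=
  [exists p : n.-tuple T, path e x p && (last x p == y)].

(* A shortest walk repeats no vertex, so minimising over walks is the same as
   minimising over simple directed paths. *)
Definition at_distance (x y : T) (n : nat) : bool :=
  walk_of_length x y n && [forall m : 'I_n, ~~ walk_of_length x y m].

End Distance.

Inductive xvertex (V : Type) := Source | Sink | Elt of V.
Arguments Source {V}.
Arguments Sink {V}.

Section XVertexFinite.
Variable V : finType.

Definition xvertex_code (x : xvertex V) : option (option V) :=
  match x with
  | Source => None
  | Sink => Some None
  | Elt v => Some (Some v)
  end.

Definition xvertex_decode (c : option (option V)) : xvertex V :=
  match c with
  | None => Source
  | Some None => Sink
  | Some (Some v) => Elt v
  end.

Lemma xvertex_codeK : cancel xvertex_code xvertex_decode.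
Proof. by case. Qed.

HB.instance Definition _ := Finite.copy (xvertex V) (can_type xvertex_codeK).

End XVertexFinite.

Section ExchangeGraph.
Variables (V : finType) (M1 M2 : matroid V) (S : {set V}).

Definition exchange_arc : rel (xvertex V) := fun x y =>
  match x, y with
  | Source, Elt a => (a \notin S) && (a |: S \in indep M1)
  | Elt a, Sink => (a \notin S) && (a |: S \in indep M2)
  | Elt u, Elt v =>
      [&& u \in S, v \notin S & v |: (S :\ u) \in indep M1]
      || [&& v \in S, u \notin S & u |: (S :\ v) \in indep M2]
  | _, _ => false
  end.

Definition layer (i : nat) : {set V} :=
  [set v | at_distance exchange_arc Source (Elt v) i].

(* The sequence (B_1, A_1, ..., B_l, A_l, B_(l+1)) is given by two families
   with 1-based indices; their values at other indices are irrelevant. *)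
Record augmenting_set (l w : nat) (B A : nat -> {set V}) : Prop :=
  AugmentingSet {
    aug_A_layer : forall k, 1 <= k <= l -> A k \subset layer (2 * k);
    aug_B_layer : forall k, 1 <= k <= l.+1 -> B k \subset layer (2 * k - 1);
    aug_A_card : forall k, 1 <= k <= l -> #|A k| = w;
    aug_B_card : forall k, 1 <= k <= l.+1 -> #|B k| = w;
    aug_first : S :|: B 1 \in indep M1;
    aug_last : S :|: B l.+1 \in indep M2;
    aug_indep1 : forall k, 1 <= k <= l -> (S :\: A k) :|: B k.+1 \in indep M1;
    aug_indep2 : forall k, 1 <= k <= l -> (S :\: A k) :|: B k \in indep M2
  }.

End ExchangeGraph.

(* ((S + B_1) - A_1 + B_2) - ... - A_l + B_(l+1), evaluated left to right *)
Fixpoint augment (V : finType) (S : {set V}) (B A : nat -> {set V}) (l : nat)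
    : {set V} :=
  match l with
  | 0 => S :|: B 1
  | k.+1 => (augment S B A k :\: A k.+1) :|: B k.+2
  end.

(* Main.v *)
(** Fix one of the matroids and say that [b] is spanned by an independent [X]
    when [b |: X] is dependent.  In the first matroid, an element of [B_(j+1)]
    ([j >= 1]) is spanned by [X_k := S - A_1 - ... - A_k] for every [k < j]:
    otherwise [S + b] or some [S - a + b] with [a] in [A_1 + ... + A_k] would be
    independent, which gives an arc shortcutting the distance from the source to
    [b].  Hence [I_k := X_l + B_(k+2) + ... + B_(l+1)] has the same span as
    [X_k], so that [X_k + B_(k+1)] being independent makes [I_k + B_(k+1)]
    independent; descending from [k = l] to [k = 0] gives the first matroid.
    The second matroid is the same argument with the indices reversed. *)

Require Import Defs.
From mathcomp Require Import all_boot.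
From mathcomp Require Import zify.

(** * Spans and exchanges in a single matroid *)

Section Matroid.
Variables (V : finType) (M : matroid V).
Implicit Types (S X Y I J : {set V}) (A B : nat -> {set V}).

Lemma indep_extend X Y :
  X \in indep M -> Y \in indep M -> #|X| <= #|Y| ->
  exists Z, [/\ Z \in indep M, X \subset Z, Z \subset X :|: Y & #|Z| = #|Y|].
Proof.
move=> + iY; move dn: (#|Y| - #|X|) => n.
elim: n X dn => [|n IHn] X dn iX leXY.
  by exists X; rewrite subsetUl; split=> //; lia.
have [|y /setDP[yY yX] iyX] := indep_exchange iX iY; first by lia.
have cyX : #|y |: X| = #|X|.+1 by rewrite cardsU1 yX.
have [||Z [iZ sZ Zs cZ]] := IHn (y |: X) _ iyX; [by lia | by lia |].
exists Z; split=> //; first exact: subset_trans (subsetUr _ _) sZ.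
apply: subset_trans Zs _; rewrite -setUA subUset sub1set.
by rewrite subxx !inE yY !orbT.
Qed.

Lemma spanned_card_le X J :
  X \in indep M -> J \in indep M ->
  {in J :\: X, forall y, y |: X \notin indep M} -> #|J| <= #|X|.
Proof.
move=> iX iJ spJ; rewrite leqNgt; apply/negP=> ltXJ.
have [y yJX iyX] := indep_exchange iX iJ ltXJ.
by have := spJ y yJX; rewrite iyX.
Qed.

(** Extend [I] from [X :|: Y] to full size. No [z] of [X] outside [I] can enter: [z |: I] would be
    independent, still spanned by [X], yet larger than [X]. Only elements of [Y] are added, and
    counting shows that all of them are. *)
Lemma indep_same_span X I Y :
  X :|: Y \in indep M -> [disjoint X & Y] -> I \in indep M ->
  {in I :\: X, forall y, y |: X \notin indep M} -> #|X| <= #|I| ->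
  I :|: Y \in indep M /\ #|I :|: Y| = #|X| + #|Y|.
Proof.
move=> iXY dXY iI spI leXI.
have iX : X \in indep M by apply: indep_sub iXY; apply: subsetUl.
have cI : #|I| = #|X|.
  by apply/eqP; rewrite eqn_leq leXI (spanned_card_le _ _ iX iI spI).
have cXY : #|X :|: Y| = #|X| + #|Y|.
  by rewrite cardsU (disjoint_setI0 dXY) cards0 subn0.
have [|Z [iZ sIZ sZ cZ]] := indep_extend _ _ iI iXY; first by rewrite cXY; lia.
have sZIY : Z \subset I :|: Y.
  apply/subsetP=> z zZ.
  have := subsetP sZ z zZ; rewrite !inE => /or3P[->//|zX|->]; last by rewrite orbT.
  have [//|zI] := boolP (z \in I).
  have izI : z |: I \in indep M.
    by apply: indep_sub iZ; rewrite subUset sub1set zZ.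
  have := spanned_card_le _ _ iX izI; rewrite cardsU1 zI cI => /(_ _) le1.
  suff: 1 + #|X| <= #|X| by lia.
  apply: le1 => y; rewrite !inE => /andP[yX /predU1P[yz|yI]].
    by rewrite yz zX in yX.
  by apply: spI; rewrite inE yX.
have eZ : Z = I :|: Y.
  by apply/eqP; rewrite eqEcard sZIY cZ cXY cardsU cI leq_subr.
by rewrite -eZ cZ.
Qed.

(* The hypothesis says that the fundamental circuit of [b] in [S] lies in [X]. *)
Lemma spanned_sub S X b :
  S \in indep M -> X \subset S -> b |: S \notin indep M ->
  {in S :\: X, forall a, b |: (S :\ a) \notin indep M} ->
  b |: X \notin indep M.
Proof.
move=> iS sXS dbS dbSa; apply/negP=> ibX.
have bS : b \notin S.
  by apply: contraNN dbS => bS; rewrite (setUidPr _) ?sub1set.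
have bX : b \notin X by apply: contra bS; apply: (subsetP sXS).
have [ltXS|leSX] := ltnP #|X| #|S|; last first.
  have eX : X = S by apply/eqP; rewrite eqEcard sXS.
  by rewrite -eX ibX in dbS.
have [|Z [iZ sZ Zs cZ]] := indep_extend _ _ ibX iS; first by rewrite cardsU1 bX.
have bZ : b \in Z by apply: (subsetP sZ); rewrite setU11.
have sXZ : X \subset Z by apply: subset_trans sZ; apply: subsetUr.
have sSZ : ~~ (S \subset Z).
  apply: contra dbS => sSZ; apply: indep_sub iZ.
  by rewrite subUset sub1set bZ.
have /subsetPn[a aS aZ] := sSZ.
have aX : a \notin X by apply: contra aZ; apply: (subsetP sXZ).
have ab : a != b by apply: contraNneq aZ => ->.
have sZa : Z \subset b |: (S :\ a).
  apply/subsetP=> z zZ; have := subsetP Zs z zZ; rewrite !inE.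
  have za : z != a by apply: contraNneq aZ => <-.
  by rewrite za /= => /orP[/orP[->//|/(subsetP sXS)->]|->]; rewrite orbT.
have eZ : Z = b |: (S :\ a).
  apply/eqP; rewrite eqEcard sZa cZ cardsU1 !inE (negPf bS) andbF /=.
  by rewrite (cardsD1 a S) aS.
by have := dbSa a; rewrite inE aX aS -eZ iZ => /(_ isT).
Qed.

(** Layers enter only through forbidden exchanges, so that both matroids can use it, the second one
    with the families reversed. Indices start at 0 here. *)
Lemma indep_layered_exchange S A B l :
  S \in indep M -> S :|: B 0 \in indep M -> [disjoint S & B 0] ->
  (forall k, k < l -> (S :\: A k) :|: B k.+1 \in indep M) ->
  (forall k, k < l -> #|A k| <= #|B k.+1|) ->
  (forall k b, k < l -> b \in B k.+1 -> b |: S \notin indep M) ->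
  (forall j k a b, j < k < l -> a \in A j -> a \in S -> b \in B k.+1 ->
     b |: (S :\ a) \notin indep M) ->
  (S :\: \bigcup_(0 <= j < l) A j) :|: \bigcup_(0 <= j < l.+1) B j \in indep M.
Proof.
move=> iS iSB0 dSB0 iSAB cAB dbS dbSa.
pose X k := S :\: \bigcup_(0 <= j < k) A j.
pose I k := X l :|: \bigcup_(k <= j < l) B j.+1.
have sXS k : X k \subset S by apply: subsetDl.
have iX k : X k \in indep M by apply: indep_sub iS; apply: sXS.
have bS k b : k < l -> b \in B k.+1 -> b \notin S.
  move=> ltkl bB; apply: contraNN (dbS k b ltkl bB) => bS.
  by rewrite (setUidPr _) ?sub1set.
have mem_cup (F : nat -> {set V}) m n x :
    x \in \bigcup_(m <= j < n) F j -> exists2 j, m <= j < n & x \in F j.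
  rewrite big_seq; elim/big_ind: _ => [|P Q IP IQ|j]; first by rewrite inE.
    by rewrite inE => /orP[].
  by rewrite mem_index_iota => ? ?; exists j.
(* Since [X l] lies in [X k], such a [y] is in some [B j.+1] with [k <= j], while every element
   removed from [S] to form [X k] is in some [A i] with [i < k]. *)
have spI k : k <= l -> {in I k :\: X k, forall y, y |: X k \notin indep M}.
  move=> lekl y; rewrite inE [y \in I k]inE => /andP[yX /orP[yXl|yB]].
    case/negP: yX; move: yXl; rewrite !inE => /andP[+ ->]; rewrite andbT.
    apply: contra; rewrite (big_cat_nat (leq0n k) lekl) //= inE => ->; exact: isT.
  have [j /andP[lekj ltjl] yBj] := mem_cup _ _ _ _ yB.
  apply: (spanned_sub S) => // [|a]; first exact: dbS yBj.
  rewrite !inE negb_and negbK => /andP[/orP[aA|/negPf->//] aS].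
  have [i /andP[_ ltik] aAi] := mem_cup _ _ _ _ aA.
  by apply: (dbSa i j) => //; lia.
(* Descent on [k = l - m]. The size bound is carried along for [indep_same_span]; it survives
   because [B k.+1] is at least as large as [A k]. *)
have iI m : m <= l -> I (l - m) \in indep M /\ #|X (l - m)| <= #|I (l - m)|.
  elim: m => [|m IHm] lt_ml.
    by rewrite subn0 /I big_geq // setU0.
  have [iIk leXI] := IHm (ltnW lt_ml).
  set k := l - m.+1; have ek : l - m = k.+1 by lia.
  have ltkl : k < l by lia.
  rewrite ek in iIk leXI.
  have sXA : X k.+1 \subset S :\: A k.
    by rewrite setDS // big_nat_recr //= subsetUr.
  have [||iIB cIB] := indep_same_span (X k.+1) (I k.+1) (B k.+1) _ _ iIk
      (spI _ ltkl) leXI.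
  - by apply: indep_sub (iSAB k ltkl); apply: setSU.
  - rewrite disjoint_sym disjoints_subset; apply/subsetP=> b bB.
    by rewrite inE; apply: contra (bS k b ltkl bB); apply: (subsetP (sXS _)).
  have -> : I k = I k.+1 :|: B k.+1.
    by rewrite /I (big_ltn ltkl) -setUA [B _ :|: _]setUC.
  split=> //; rewrite cIB; apply: leq_trans (leq_add (leqnn _) (cAB k ltkl)).
  apply: leq_trans (leq_card_setU _ _); apply/subset_leq_card/subsetP=> x.
  rewrite /X (big_nat_recr k) //= !inE negb_or => /andP[-> ->].
  by case: (x \in A k).
have [iI0 leXI0] := iI l (leqnn l); rewrite subnn in iI0 leXI0.
have eX0 : X 0 = S by rewrite /X big_geq // setD0.
have [||iIB _] := indep_same_span (X 0) (I 0) (B 0) _ _ iI0 (spI 0 (leq0n l)) leXI0.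
- by rewrite eX0.
- by rewrite eX0.
by move: iIB; rewrite /I -setUA big_nat_recl // [B 0 :|: _]setUC.
Qed.

End Matroid.

(** * Walks and distances in a directed graph *)

Section Walks.
Variables (T : finType) (e : rel T).

Lemma walk_of_lengthP x y n :
  reflect (exists p, [/\ size p = n, path e x p & last x p = y])
          (walk_of_length e x y n).
Proof.
apply: (iffP existsP) => [[p /andP[ep /eqP lp]]|[p [sp ep lp]]].
  by exists p; rewrite size_tuple.
by exists (tcast sp (in_tuple p)); rewrite val_tcast /= ep lp eqxx.
Qed.

Lemma walk_of_length_step x y z n :
  walk_of_length e x y n -> e y z -> walk_of_length e x z n.+1.
Proof.
move=> /walk_of_lengthP[p [sp ep lp]] eyz; apply/walk_of_lengthP.
by exists (rcons p z); rewrite size_rcons rcons_path last_rcons sp ep lp.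
Qed.

Lemma at_distance_le x y n m :
  at_distance e x y n -> walk_of_length e x y m -> n <= m.
Proof.
move=> /andP[_ /forallP min_n] wm; rewrite leqNgt; apply/negP=> ltmn.
by have := min_n (Ordinal ltmn); rewrite wm.
Qed.

Lemma at_distance_step x y z n m :
  at_distance e x y n -> at_distance e x z m -> e y z -> m <= n.+1.
Proof.
move=> /andP[wy _] dz eyz; apply: at_distance_le dz _.
exact: walk_of_length_step eyz.
Qed.

End Walks.

(** * Distance layers of the exchange graph *)

Section ExchangeGraphLayers.
Variables (V : finType) (M1 M2 : matroid V) (S : {set V}).
Notation arc := (exchange_arc M1 M2 S).
Notation layer := (layer M1 M2 S).

(** Arcs between elements cross between [S] and its complement, and the source leads only outside
    [S]. No walk passes through the sink or returns to the source. *)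
Lemma exchange_walk_parity v n :
  walk_of_length arc Source (Elt v) n -> (v \in S) = ~~ odd n.
Proof.
move=> /walk_of_lengthP[p []]; elim/last_ind: p n v => // p x IHp n v.
rewrite size_rcons rcons_path last_rcons => <- /andP[ep exv] xv.
move: exv; rewrite {x}xv; move py: (last Source p) => y.
case: y py => [||u] py //=.
  case/lastP: p py ep {IHp} => [_ _ /andP[/negPf->]//|p y].
  rewrite last_rcons => ->; rewrite rcons_path => /andP[_].
  by case: (last Source p).
rewrite negbK => /orP[]/and3P[uS vS _].
  by have := IHp _ u erefl ep py; rewrite uS (negPf vS) => /esym/negPf.
by have := IHp _ v; have := IHp _ u erefl ep py; rewrite uS (negPf vS) => /esym/negbFE.
Qed.

Lemma layer_parity i v : v \in layer i -> (v \in S) = ~~ odd i.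
Proof. by rewrite inE => /andP[/exchange_walk_parity]. Qed.

Lemma layer_source_arc i b :
  b \in layer i -> b \notin S -> b |: S \in indep M1 -> i <= 1.
Proof.
rewrite inE => db bS ib; apply: at_distance_le db _.
by apply/walk_of_lengthP; exists [:: Elt b]; rewrite /= bS ib.
Qed.

Lemma layer_sink_arc i n b :
  b \in layer i -> at_distance arc Source Sink n ->
  b \notin S -> b |: S \in indep M2 -> n <= i.+1.
Proof.
rewrite inE => db dt bS ib; apply: at_distance_step db dt _.
by rewrite /= bS ib.
Qed.

Lemma layer_arc1 i j a b :
  a \in layer i -> b \in layer j -> a \in S -> b \notin S ->
  b |: (S :\ a) \in indep M1 -> j <= i.+1.
Proof.
rewrite !inE => da db aS bS ib; apply: at_distance_step da db _.
by rewrite /= aS bS ib.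
Qed.

Lemma layer_arc2 i j a b :
  a \in layer i -> b \in layer j -> a \in S -> b \notin S ->
  b |: (S :\ a) \in indep M2 -> i <= j.+1.
Proof.
rewrite !inE => da db aS bS ib; apply: at_distance_step db da _.
by rewrite /= aS bS ib orbT.
Qed.

End ExchangeGraphLayers.

(** Inclusion suffices, as independence passes to subsets, and it holds for arbitrary families, even
    if some [A] removes elements of an earlier [B]. *)
Lemma augment_subset (V : finType) (S : {set V}) (B A : nat -> {set V}) l :
  augment S B A l \subset
    (S :\: \bigcup_(0 <= j < l) A j.+1) :|: \bigcup_(0 <= j < l.+1) B j.+1.
Proof.
elim: l => [|l IHl] /=; first by rewrite big_geq // setD0 big_nat1.
rewrite (big_nat_recr l) // (big_nat_recr l.+1) //= setUA.
apply: setSU; rewrite setDUr.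
apply: subset_trans (setSD _ IHl) _; apply/subsetP=> x; rewrite !inE.
by case: (x \in A _); case: (x \in S); rewrite ?andbF ?andbT.
Qed.

(** * The two matroids of the exchange graph *)

Theorem theorem6p5 (V : finType) (M1 M2 : matroid V) (S : {set V})
    (l w : nat) (B A : nat -> {set V}) :
  S \in indep M1 :&: indep M2 ->
  at_distance (exchange_arc M1 M2 S) Source Sink (2 * l.+1) ->
  augmenting_set M1 M2 S l w B A ->
  augment S B A l \in indep M1 :&: indep M2.
Proof.
move=> /setIP[iS1 iS2] dt [sA sB cA cB iB1 iBl i1 i2].
have lA k a : 1 <= k <= l -> a \in A k -> a \in layer M1 M2 S (2 * k).
  by move=> /sA/subsetP; apply.
have lB k b : 1 <= k <= l.+1 -> b \in B k -> b \in layer M1 M2 S (2 * k - 1).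
  by move=> /sB/subsetP; apply.
have BS k b : 1 <= k <= l.+1 -> b \in B k -> b \notin S.
  by move=> hk /(lB _ _ hk)/layer_parity->; lia.
have dSB k : 1 <= k <= l.+1 -> [disjoint S & B k].
  move=> hk; rewrite disjoint_sym disjoints_subset; apply/subsetP=> b bB.
  by rewrite inE (BS k).
rewrite inE; apply/andP; split; apply: indep_sub (augment_subset _ _ _ _ _) _.
  apply: (@indep_layered_exchange V M1 S (fun j => A j.+1) (fun j => B j.+1)) => //.
  - exact: dSB.
  - by move=> k ltkl; apply: i1.
  - by move=> k ltkl; rewrite cA ?cB //; lia.
  - move=> k b ltkl bB; apply/negP=> ib.
    have hk : 1 <= k.+2 <= l.+1 by lia.
    by have := layer_source_arc _ _ _ _ _ _ (lB _ _ hk bB) (BS _ _ hk bB) ib; lia.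
  (* The arc from [a] in layer [2 * j.+1] to [b] in layer [2 * k.+2 - 1] would force [k <= j]. *)
  move=> j k a b hjk aA aS bB; apply/negP=> ib.
  have hk : 1 <= k.+2 <= l.+1 by lia.
  have hj : 1 <= j.+1 <= l by lia.
  have := layer_arc1 _ _ _ _ _ _ _ _ (lA _ _ hj aA) (lB _ _ hk bB) aS (BS _ _ hk bB) ib.
  by lia.
(* Reversal makes [B l.+1] the initial set and pairs [A (l - k)] with [B (l - k)], as in the second
   matroid's conditions. *)
rewrite big_nat_rev [X in _ :|: X]big_nat_rev /=.
have -> : \bigcup_(0 <= j < l) A (0 + l - j.+1).+1 = \bigcup_(0 <= j < l) A (l - j).
  by apply: eq_big_nat => j hj; congr (A _); lia.
have -> : \bigcup_(0 <= j < l.+1) B (0 + l.+1 - j.+1).+1 =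
          \bigcup_(0 <= j < l.+1) B (l.+1 - j).
  by apply: eq_big_nat => j hj; congr (B _); lia.
apply: (@indep_layered_exchange V M2 S (fun j => A (l - j)) (fun j => B (l.+1 - j))) => //.
- by apply: dSB; lia.
- by move=> k ltkl; rewrite subSS; apply: i2; lia.
- by move=> k ltkl; rewrite cA ?cB //; lia.
(* Going from [b] to the sink would give a walk of length [2 * (l - k)], below [2 * l.+1]. *)
- move=> k b ltkl; rewrite subSS => bB; apply/negP=> ib.
  have hk : 1 <= l - k <= l.+1 by lia.
  by have := layer_sink_arc _ _ _ _ _ _ _ (lB _ _ hk bB) dt (BS _ _ hk bB) ib; lia.
move=> j k a b hjk aA aS; rewrite subSS => bB; apply/negP=> ib.
have hk : 1 <= l - k <= l.+1 by lia.
have hj : 1 <= l - j <= l by lia.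
have := layer_arc2 _ _ _ _ _ _ _ _ (lA _ _ hj aA) (lB _ _ hk bB) aS (BS _ _ hk bB) ib.
by lia.
Qed.
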